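(* There exists a constant $c$ such that every graph $H$ with $n$ vertices satisfies \[r_{ind}(H) \leq 2^{c n \log n}.\]
   Context: A graph $H$ is an induced subgraph of a graph $G$ if $V(H)\subseteq V(G)$ and two vertices of $H$ are adjacent in $H$ if and only if they are adjacent in $G$. The induced Ramsey number $r_{ind}(H)$ is the smallest natural number $N$ for which there is a graph $G$ on $N$ vertices such that every two-coloring of the edges of $G$ contains an induced subgraph of $G$ isomorphic to $H$ all of whose edges have the same color. Logarithms are to base $2$. *)

(* Defs.v *)
From mathcomp Require Import all_boot all_order all_algebra.
From mathcomp Require Import all_classical all_reals all_analysis.

Set Implicit Arguments.
Unset Strict Implicit.
Unset Printing Implicit Defensive.

Record sgraph := SGraph {
  vertex :> finType;
  adj : rel vertex;
  adj_sym : symmetric adj;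
  adj_irr : irreflexive adj }.

Definition edges (G : sgraph) : {set {set G}} :=
  [set e | [exists x, exists y, adj x y && (e == [set x; y]%SET)]].

Section Induced.
Variables (G : sgraph) (S : {set G}).

Definition induced_adj : rel {x : G | x \in S} :=
  fun u v => adj (val u) (val v).

Lemma induced_adj_sym : symmetric induced_adj.
Proof. by move=> u v; exact: adj_sym. Qed.

Lemma induced_adj_irr : irreflexive induced_adj.
Proof. by move=> u; exact: adj_irr. Qed.

Definition induced : sgraph := SGraph induced_adj_sym induced_adj_irr.

End Induced.

Definition isomorphic (F H : sgraph) : Prop :=
  exists f : F -> H, bijective f /\ forall x y, adj (f x) (f y) = adj x y.

(* The values of [col] outside [edges G] are irrelevant, so quantifying over
   [col] amounts to quantifying over the two-colorings of the edges of [G]. *)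
Definition monochromatic (G : sgraph) (col : {set G} -> bool) (S : {set G}) :
    Prop :=
  exists b : bool, forall e, e \in edges G -> e \subset S -> col e = b.

Definition induced_arrow (G H : sgraph) : Prop :=
  forall col : {set G} -> bool,
    exists S : {set G}, isomorphic (induced S) H /\ monochromatic col S.

(* [r_ind H = N], as a relation: that some such [N] exists is a theorem, and a
   total function would need a junk value. *)
Definition is_r_ind (H : sgraph) (N : nat) : Prop :=
  (exists G : sgraph, #|G| = N /\ induced_arrow G H) /\
  (forall G : sgraph, induced_arrow G H -> N <= #|G|).

Lemma is_r_ind_uniq (H : sgraph) (M N : nat) :
  is_r_ind H M -> is_r_ind H N -> M = N.
Proof.
move=> [[G [<- GH]] minM] [[G' [<- GH']] minN].
by apply/eqP; rewrite eqn_leq minM // minN.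
Qed.

(* [ln 0 = 0] in the library. *)
Definition log2 (R : realType) (x : R) : R := (ln x / ln 2)%R.

(* Main.v *)
Require Import Defs.
From mathcomp Require Import all_boot all_order all_algebra.
From mathcomp Require Import all_classical all_reals all_analysis.
From mathcomp Require Import fintype finset zify ring.

(* The host graph is a "Hadamard" graph: its signed adjacency matrix is a tensor power of a symmetric Hadamard matrix of order 4 with constant diagonal, so that, on N vertices, every vertex set W is split almost evenly into neighbors and non-neighbors by all but N^(1/4) vertices (Chebyshev).
   Fix a two-coloring and let s = 2^k >= n. If, inside a set A, color c' has density at least about 2^(-2k) between all pairs of subsets of relative size s^(-O(z)) 2^(-O(s)), then A is a leaf in which z vertices can be embedded greedily in color c'. Otherwise two large subsets X, Y of A span almost no edges of color c'; recursing in X and in (a large part of) Y with the target for the opposite color c halved, either some recursive call succeeds for c', or two structures for c can be put together, with few edges of color c' between them. Always halving the larger of the two targets makes the exponents of the losses s^(-O(z)) sum geometrically to O(s), while the factors 2^(-O(s)) are paid O(k) times.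
   One obtains, in one color c, leaves of total order s such that vertices of earlier leaves have few neighbors of the wrong color in later ones. Any graph on s vertices is embedded in color c leaf by leaf: a chosen vertex shrinks the candidate sets of its own leaf by the density factor, and those of the later leaves by about 1/2 only, by pseudorandomness, which also keeps the wrong-colored degrees towards these later candidate sets small. *)

Set Implicit Arguments.
Unset Strict Implicit.
Unset Printing Implicit Defensive.

Import Order.TTheory GRing.Theory Num.Theory.

(** * A pseudorandom graph *)

(** The all-ones matrix minus twice the antidiagonal permutation matrix: two distinct rows differ in
    exactly two columns, hence are orthogonal. As [a + a] is never 3, the diagonal is 1, which makes
    the graph below loopless. *)
Definition hadamard4 (a b : 'I_4) : int := if a + b == 3 then (- 1)%R else 1%R.

Definition hadamard (d : nat) (x y : {ffun 'I_d -> 'I_4}) : int :=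
  (\prod_(i < d) hadamard4 (x i) (y i))%R.

Lemma hadamardC d : commutative (@hadamard d).
Proof. by move=> x y; apply: eq_bigr => i _; rewrite /hadamard4 addnC. Qed.

Lemma hadamardxx d x : @hadamard d x x = 1%R.
Proof.
by rewrite /hadamard big1 // => i _; rewrite /hadamard4; case: (x i) => [[|[|[|[|]]]]].
Qed.

Lemma hadamard_sign d x y : @hadamard d x y = 1%R \/ @hadamard d x y = (- 1)%R.
Proof.
rewrite /hadamard; elim/big_ind: _ => [|a b [->|->] [->|->]|i _]; first by left.
- by left.
- by right.
- by right.
- by left.
- by rewrite /hadamard4; case: ifP; [right | left].
Qed.

Lemma hadamard4_ortho (a b : 'I_4) : a != b ->
  (\sum_(c < 4) hadamard4 c a * hadamard4 c b = 0)%R.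
Proof.
rewrite !big_ord_recr big_ord0 /= /hadamard4 /=.
by case: a b => [[|[|[|[|]]]]] // ? [[|[|[|[|]]]]].
Qed.

Lemma hadamard_ortho d x y : x != y ->
  (\sum_v @hadamard d v x * hadamard v y = 0)%R.
Proof.
move=> neq_xy.
have -> : (\sum_v @hadamard d v x * hadamard v y =
  \sum_(v : {ffun 'I_d -> 'I_4}) \prod_i (hadamard4 (v i) (x i) * hadamard4 (v i) (y i)))%R.
  by apply: eq_bigr => v _; rewrite -big_split.
rewrite -(bigA_distr_bigA (fun i c => hadamard4 c (x i) * hadamard4 c (y i))%R) /=.
have [i neq_i] : exists i, x i != y i.
  apply/existsP; apply: contraNT neq_xy; rewrite negb_exists => /forallP eq_xy.
  by apply/eqP/ffunP => i; apply/eqP; have := eq_xy i; rewrite negbK.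
by rewrite (bigD1 i) //= hadamard4_ortho ?mul0r.
Qed.

(** Parseval: once the square is expanded, orthogonality leaves only the terms with [w = w'], each
    summing to [4 ^ d]. *)
Lemma hadamard_second_moment d (W : {set {ffun 'I_d -> 'I_4}}) :
  (\sum_v (\sum_(w in W) hadamard v w) ^+ 2 = (4 ^ d * #|W|)%:Z)%R.
Proof.
have -> : (\sum_v (\sum_(w in W) hadamard v w) ^+ 2 =
  \sum_(w in W) \sum_(w' in W) \sum_v hadamard v w * hadamard v w')%R.
  under eq_bigr => v _ do rewrite expr2 mulr_suml.
  rewrite exchange_big; apply: eq_bigr => w _ /=.
  under eq_bigr => v _ do rewrite mulr_sumr.
  by rewrite exchange_big.
transitivity (\sum_(w in W) (4 ^ d)%:Z)%R; last first.
  by rewrite sumr_const PoszM -[(_ *+ _)%R]mulr_natr natz.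
apply: eq_bigr => w Ww; rewrite (bigD1 w) //= [X in (_ + X)%R]big1 ?addr0.
  transitivity (\sum_(v : {ffun 'I_d -> 'I_4}) 1 : int)%R.
    by apply: eq_bigr => v _; case: (hadamard_sign v w) => ->.
  by rewrite sumr_const card_ffun !card_ord natz.
by move=> w' /andP[_ neq]; rewrite hadamard_ortho // eq_sym.
Qed.

(* [v] itself counts as a non-neighbor of [v]. *)
Definition typical (T : finType) (adj : rel T) (z : nat) (W : {set T}) (v : T) :=
  [forall b, (#|W| <= 2 * #|[set w in W | adj v w == b]| + z) &&
             (2 * #|[set w in W | adj v w == b]| <= #|W| + z)].

Definition hadamard_adj d : rel {ffun 'I_d -> 'I_4} :=
  fun x y => hadamard x y == (- 1)%R.

Lemma hadamard_adj_sym d : symmetric (@hadamard_adj d).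
Proof. by move=> x y; rewrite /hadamard_adj hadamardC. Qed.

Lemma hadamard_adj_irr d : irreflexive (@hadamard_adj d).
Proof. by move=> x; rewrite /hadamard_adj hadamardxx. Qed.

Lemma hadamard_sumE d (W : {set {ffun 'I_d -> 'I_4}}) v :
  (\sum_(w in W) hadamard v w = #|[set w in W | hadamard_adj v w == false]|%:Z
     - #|[set w in W | hadamard_adj v w == true]|%:Z)%R.
Proof.
rewrite (bigID (hadamard_adj v)) /= addrC; congr (_ + _)%R.
  rewrite (eq_bigr (fun=> 1%R)).
    by rewrite sumr_const natz; congr (Posz _); apply: eq_card => w; rewrite !inE eqbF_neg.
  by move=> w /andP[_]; rewrite /hadamard_adj; case: (hadamard_sign v w) => ->.
rewrite (eq_bigr (fun=> - 1%R)%R); last by move=> w /andP[_ /eqP].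
rewrite sumr_const mulNrn natz; congr (- Posz _)%R.
by apply: eq_card => w; rewrite !inE eqb_id.
Qed.

Lemma card_split (T : finType) (W : {set T}) (P : pred T) :
  #|W| = #|[set w in W | P w == true]| + #|[set w in W | P w == false]|.
Proof.
rewrite -(cardsID [set w | P w] W); congr (_ + _); apply: eq_card => w.
  by rewrite !inE eqb_id.
by rewrite !inE eqbF_neg andbC.
Qed.

(** Chebyshev: the second moment is at most [2 ^ (16 * q)], and each atypical [v] contributes at
    least [2 ^ (14 * q)] to it. *)
Lemma hadamard_typical q (W : {set {ffun 'I_(4 * q) -> 'I_4}}) :
  #|[set v | ~~ typical (@hadamard_adj (4 * q)) (2 ^ (7 * q)) W v]| <= 2 ^ (2 * q).
Proof.
set B := [set v | _].
have cardT : (4 ^ (4 * q) = 2 ^ (8 * q))%N by rewrite -[8]/(2 * 4)%N -mulnA [RHS]expnM.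
have card_le : #|W| <= 2 ^ (8 * q).
  by rewrite -cardT (leq_trans (max_card _)) // card_ffun !card_ord.
have le_sum : ((#|B| * 2 ^ (14 * q))%:Z <= (4 ^ (4 * q) * #|W|)%:Z)%R.
  rewrite -hadamard_second_moment (bigID (mem B)) /= -[X in (X <= _)%R]addr0.
  apply: lerD; last by apply: sumr_ge0 => v _; apply: sqr_ge0.
  have -> : ((#|B| * 2 ^ (14 * q))%:Z = \sum_(v in B) (2 ^ (14 * q))%:Z :> int)%R.
    by rewrite sumr_const PoszM mulrC -[(_ *+ _)%R]mulr_natr natz.
  apply: ler_sum => v; rewrite !inE negb_forall => /existsP[b].
  rewrite hadamard_sumE (card_split W (hadamard_adj v)).
  have -> : (2 ^ (14 * q) = (2 ^ (7 * q)) ^ 2)%N by rewrite -expnM; congr (2 ^ _); lia.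
  rewrite -mulnn PoszM expr2; move: (2 ^ (7 * q)) => z.
  set p := #|[set w in W | _ == true]|; set m := #|[set w in W | _ == false]|.
  by case: b; rewrite -/p -/m => ?; nia.
rewrite -(leq_pmul2r (expn_gt0 2 (14 * q))).
apply: leq_trans (_ : 4 ^ (4 * q) * #|W| <= _).
  by move: le_sum; rewrite lez_nat.
rewrite cardT (leq_trans (leq_mul (leqnn _) card_le)) // -!expnD leq_exp2l //; lia.
Qed.

(** * Layered structures in a two-coloring *)

Lemma sum_card_nbr (T : finType) (e : rel T) (A B : {set T}) : symmetric e ->
  \sum_(x in A) #|B :&: [set y | e x y]| = \sum_(y in B) #|A :&: [set x | e y x]|.
Proof.
move=> e_sym.
under eq_bigr => x _ do rewrite -sum1dep_card big_mkcondr /=.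
under [RHS]eq_bigr => y _ do rewrite -sum1dep_card big_mkcondr /=.
rewrite exchange_big /=; apply: eq_bigr => y _; apply: eq_bigr => x _.
by rewrite !inE e_sym.
Qed.

(** Markov's inequality, by double counting the [e]-edges between [L] and [Y]. *)
Lemma card_dense_le (T : finType) (e : rel T) (p h : nat) (L Y : {set T}) :
  symmetric e -> 0 < #|L| ->
  (forall x, x \in L -> 2 ^ p * #|Y :&: [set y | e x y]| <= #|Y|) ->
  2 ^ p * #|[set y in Y | #|L| < 2 ^ h * #|L :&: [set x | e y x]|]| <= 2 ^ h * #|Y|.
Proof.
move=> e_sym L_gt0 sparse; set B := [set y in Y | _].
have lower : #|B| * #|L| <= 2 ^ h * \sum_(y in Y) #|L :&: [set x | e y x]|.
  rewrite -sum_nat_const big_distrr /=.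
  apply: (@leq_trans (\sum_(y in B) 2 ^ h * #|L :&: [set x | e y x]|)).
    by apply: leq_sum => y; rewrite inE => /andP[_ /ltnW].
  by rewrite [leqRHS](big_setID B) /= (setIidPr _) ?leq_addr // /B setIdE subsetIl.
have upper : 2 ^ p * \sum_(x in L) #|Y :&: [set y | e x y]| <= #|L| * #|Y|.
  by rewrite big_distrr /= -sum_nat_const; apply: leq_sum => x /sparse.
rewrite -sum_card_nbr // in lower.
rewrite -(leq_pmul2r L_gt0).
move: lower upper; set S := \sum_(x in L) _; move: (2 ^ h) (2 ^ p) => u v; nia.
Qed.

Section Layers.

Variables (T : finType) (e : bool -> rel T) (k M : nat).

(** Degrees of single vertices replace edge counts: the negation makes every vertex of [X] sparse
    towards [Y], which passes to subsets of [X]. *)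
Definition bidense c (A : {set T}) (w : nat) :=
  forall X Y : {set T}, X \subset A -> Y \subset A ->
    #|A| <= 2 ^ w * #|X| -> #|A| <= 2 ^ w * #|Y| ->
    exists2 x, x \in X & #|Y| <= 2 ^ (2 * k + 4) * #|Y :&: [set y | e c x y]|.

(* [2 ^ scale z] is the loss in size tolerated while [z] vertices are embedded in one leaf: [2 k + 5] bits per vertex of the leaf, one bit per vertex of another leaf, and [k + 3] bits to absorb the exceptional vertices. *)
Definition scale (z : nat) := (2 * k + 5) * z + 2 ^ k + k + 3.

(** For [b <= a], lowering [a] by one frees at least [scale (2 ^ b) + 1] bits: the geometric term
    pays for [(2 * k + 5) * 2 ^ b], the linear one for the rest. The extra bit covers the passage
    from [Y] to half of it. *)
Definition loss (a b : nat) :=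
  2 * (2 * k + 5) * (2 ^ a + 2 ^ b) + (a + b) * (2 ^ k + k + 4).

(* Positions [i < m] are grouped in consecutive blocks, [st i] being the first position of the block of [i]. *)
Record layered c m (A : {set T}) (L : nat -> {set T}) (st : nat -> nat) : Prop :=
 Layered {
  layered_sub : forall i, i < m -> L i \subset A;
  layered_card : forall i, i < m -> M <= #|L i|;
  layered_start : forall i, st i <= i;
  layered_block : forall i j, i < j < m -> st i = st j \/ i < st j;
  layered_same : forall i j, i < j < m -> st i = st j ->
    L i = L j /\ exists2 z, j < st j + z & bidense c (L j) (scale z);
  layered_cross : forall i j, i < j < m -> st i <> st j -> forall y, y \in L i ->
    2 ^ (k + 3) * #|L j :&: [set x | e (~~ c) y x]| <= #|L j| }.

Lemma layeredS c m (A B : {set T}) L st : A \subset B -> layered c m A L st -> layered c m B L st.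
Proof.
move=> sAB [? ? ? ? ? ?]; split=> // i lt_im.
by apply: subset_trans sAB; auto.
Qed.

Lemma layered_leaf c z (A : {set T}) : M <= #|A| -> (z <= 1 \/ bidense c A (scale z)) ->
  layered c z A (fun=> A) (fun=> 0).
Proof.
move=> leMA bdA; split=> // i j ij; first by left.
move=> _; split=> //; exists z; first lia.
by case: bdA => // ?; lia.
Qed.

Lemma layered_cat c m1 m2 (A : {set T}) L1 st1 L2 st2 :
  layered c m1 A L1 st1 -> layered c m2 A L2 st2 ->
  (forall i y, i < m2 -> y \in \bigcup_(j < m1) L1 j ->
    2 ^ (k + 3) * #|L2 i :&: [set x | e (~~ c) y x]| <= #|L2 i|) ->
  layered c (m1 + m2) A (fun i => if i < m1 then L1 i else L2 (i - m1))
    (fun i => if i < m1 then st1 i else m1 + st2 (i - m1)).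
Proof.
move=> lay1 lay2 cross12.
have st1_le := layered_start lay1; have st2_le := layered_start lay2.
split=> [i lti|i lti|i|i j ltij|i j ltij|i j ltij].
- by case: ifP => ?; [apply: (layered_sub lay1) | apply: (layered_sub lay2); lia].
- by case: ifP => ?; [apply: (layered_card lay1) | apply: (layered_card lay2); lia].
- by case: ifP => ?; [exact: st1_le | have := st2_le (i - m1); lia].
- case: ifP => lti; case: ifP => ltj; [|right|lia|]; try lia.
    by apply: (layered_block lay1); lia.
  case: (@layered_block _ _ _ _ _ lay2 (i - m1) (j - m1)); first lia.
    by move=> ->; left.
  by right; lia.
- case: ifP => lti; case: ifP => ltj; try lia.
  + by apply: (layered_same lay1); lia.
  + by move=> eq_st; have := st1_le i; lia.
  + move=> /addnI eq_st.
    have [|-> [z ltz bd]] := layered_same lay2 _ eq_st; first lia.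
    by split=> //; exists z => //; lia.
- case: ifP => lti; case: ifP => ltj; try lia.
  + by apply: (layered_cross lay1); lia.
  + move=> _ y Ly; apply: cross12; first lia.
    by apply/bigcupP; exists (Ordinal lti).
  + by move=> neq_st; apply: (layered_cross lay2); [lia|move=> eq; apply: neq_st; rewrite eq].
Qed.

(** By double counting, each [L i] excludes at most a fraction [1 / 2 ^ (k + 1)] of [Y], and there
    are at most [2 ^ k] of them. *)
Lemma card_sparse_ge c a (X Y : {set T}) (L : nat -> {set T}) st :
  symmetric (e (~~ c)) -> 0 < M -> a <= k -> layered c (2 ^ a) X L st ->
  (forall x, x \in X -> 2 ^ (2 * k + 4) * #|Y :&: [set y | e (~~ c) x y]| <= #|Y|) ->
  #|Y| <= 2 * #|[set y in Y | [forall i : 'I_(2 ^ a),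
     2 ^ (k + 3) * #|L i :&: [set x | e (~~ c) y x]| <= #|L i|]]|.
Proof.
move=> e_sym M_gt0 le_ak lay sparse; set Y0 := [set y in Y | _].
pose B i := [set y in Y | #|L i| < 2 ^ (k + 3) * #|L i :&: [set x | e (~~ c) y x]|].
have leB (i : 'I_(2 ^ a)) : 2 ^ (2 * k + 4) * #|B i| <= 2 ^ (k + 3) * #|Y|.
  apply: card_dense_le => // [|x Lx]; first exact: leq_trans (layered_card lay _).
  by apply: sparse; apply: subsetP Lx; apply: (layered_sub lay).
have leYD : #|Y :\: Y0| <= \sum_(i < 2 ^ a) #|B i|.
  apply: (@leq_trans #|\bigcup_(i < 2 ^ a) B i|); last first.
    by elim/big_rec2: _ => [|i n S _ le]; rewrite ?cards0 // (leq_trans (leq_card_setU _ _)) ?leq_add2l.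
  apply: subset_leq_card; apply/subsetP => y; rewrite !inE => /andP[+ Yy].
  rewrite Yy /= negb_forall => /existsP[i]; rewrite -ltnNge => lti.
  by apply/bigcupP; exists i; rewrite // inE Yy.
have leYD2 : 2 ^ (2 * k + 4) * #|Y :\: Y0| <= 2 ^ k * (2 ^ (k + 3) * #|Y|).
  apply: (leq_trans (leq_mul (leqnn _) leYD)); rewrite big_distrr /=.
  apply: (@leq_trans (\sum_(i < 2 ^ a) 2 ^ (k + 3) * #|Y|)); first exact: leq_sum.
  by rewrite sum_nat_const card_ord leq_mul2r leq_exp2l // le_ak orbT.
have := cardsID Y0 Y; rewrite (setIidPr _) => [|]; last by rewrite /Y0 setIdE subsetIl.
move: leYD2; have -> : 2 ^ (2 * k + 4) = 2 * (2 ^ k * 2 ^ (k + 3)).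
  by rewrite -expnD -expnS; congr (2 ^ _); lia.
have : 0 < 2 ^ k * 2 ^ (k + 3) by rewrite muln_gt0 !expn_gt0.
rewrite (mulnA (2 ^ k) _ #|Y|); move: (2 ^ k * _) => u; nia.
Qed.

Lemma layered_exists c a b (A : {set T}) :
  (forall c, symmetric (e c)) -> 0 < M -> a <= k -> b <= k ->
  M * 2 ^ loss a b <= #|A| ->
  (exists L st, layered c (2 ^ a) A L st) \/ (exists L st, layered (~~ c) (2 ^ b) A L st).
Proof.
move=> e_sym M_gt0; have [m] := ubnP (a + b); elim: m => // m IH in a b c A *.
(* Exchanging the colors exchanges the targets. Bidensity is then tested in the color [~~ c] of the
   smaller target, so that a failure costs only [scale (2 ^ b)]. *)
wlog le_ba : a b c / b <= a.
  move=> hwlog ltm lea leb leA.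
  case: (leqP b a) => [le_ba|lt_ab]; first exact: hwlog.
  case: (hwlog b a (~~ c) (ltnW lt_ab)) => //.
  - by rewrite addnC.
  - by move: leA; rewrite /loss (addnC a) (addnC (2 ^ a)).
  - by right.
  - by rewrite negbK; left.
move=> ltm lea leb leA.
have leMA : M <= #|A| by apply: leq_trans leA; rewrite leq_pmulr // expn_gt0.
case: b => [|b] in le_ba ltm leb leA *.
  by right; exists (fun=> A), (fun=> 0); apply: layered_leaf => //; left.
case: a => [//|a] in le_ba ltm lea leA *.
case: (pselect (bidense (~~ c) A (scale (2 ^ b.+1)))) => [bd|nbd].
  by right; exists (fun=> A), (fun=> 0); apply: layered_leaf => //; right.
have [X [Y [[sXA sYA] [leX leY] sparse]]] : exists X Y : {set T},
  [/\ X \subset A /\ Y \subset A,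
      #|A| <= 2 ^ scale (2 ^ b.+1) * #|X| /\ #|A| <= 2 ^ scale (2 ^ b.+1) * #|Y|
    & forall x, x \in X ->
       2 ^ (2 * k + 4) * #|Y :&: [set y | e (~~ c) x y]| <= #|Y| ].
  apply: contrapT => noXY; apply: nbd => X Y sX sY leX leY.
  apply: contrapT => nox; apply: noXY; exists X, Y; split=> // x Xx.
  by apply: contrapT => /negP; rewrite -ltnNge => /ltnW ?; apply: nox; exists x.
have le_loss : scale (2 ^ b.+1) + 1 + loss a b.+1 <= loss a.+1 b.+1.
  have : 2 ^ b.+1 <= 2 ^ a.+1 by rewrite leq_exp2l.
  by rewrite /loss /scale !expnS; move: (2 ^ a) (2 ^ b) (2 ^ k) => x y z; nia.
have descend (Z : {set T}) : #|A| <= 2 ^ (scale (2 ^ b.+1) + 1) * #|Z| -> M * 2 ^ loss a b.+1 <= #|Z|.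
  move=> leZ; rewrite -(leq_pmul2l (expn_gt0 2 (scale (2 ^ b.+1) + 1))).
  apply: leq_trans leZ; apply: leq_trans leA.
  by rewrite mulnCA -expnD leq_pmul2l // leq_exp2l.
have IHa (Z : {set T}) : #|A| <= 2 ^ (scale (2 ^ b.+1) + 1) * #|Z| ->
  (exists L st, layered c (2 ^ a) Z L st) \/ (exists L st, layered (~~ c) (2 ^ b.+1) Z L st).
  by move=> /descend leZ; apply: IH => //; lia.
(* [X] is treated first because [Y0] depends on the leaves found in it. These leaves are
   nevertheless placed last: the degrees under control go from [Y0] into them. *)
have [|[L2 [st2 lay2]]|[L [st lay]]] := IHa X; last 2 first.
- have leY0 := card_sparse_ge (e_sym _) M_gt0 (ltnW lea) lay2 sparse.
  set Y0 := finset _ in leY0.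
  have sY0A : Y0 \subset A by apply: subset_trans sYA; rewrite /Y0 setIdE subsetIl.
  have [|[L1 [st1 lay1]]|[L [st lay]]] := IHa Y0.
  + apply: (leq_trans leY); rewrite expnD expn1 -mulnA leq_mul2l leY0; exact: orbT.
  + left; eexists; eexists; rewrite expnS mul2n -addnn.
    apply: layered_cat (layeredS sY0A lay1) (layeredS sXA lay2) _ => i y lti.
    move=> /bigcupP[j _ /(subsetP (layered_sub lay1 (ltn_ord j)))].
    by rewrite inE => /andP[_ /forallP/(_ (Ordinal lti))].
  + by right; exists L, st; apply: layeredS lay.
- by right; exists L, st; apply: layeredS lay.
- by apply: (leq_trans leX); rewrite leq_mul2r leq_exp2l // leq_addr orbT.
Qed.

End Layers.

(** * Greedy embedding into a layered structure *)

Lemma card_bigcup_le (T I : finType) (P : pred I) (B : I -> {set T}) m :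
  (forall i, P i -> #|B i| <= m) -> #|\bigcup_(i | P i) B i| <= #|I| * m.
Proof.
move=> leB; apply: (@leq_trans (\sum_(i | P i) m)).
  elim/big_rec2: _ => [|i n S Pi le]; first by rewrite cards0.
  by rewrite (leq_trans (leq_card_setU _ _)) ?leq_add ?leB.
by rewrite sum_nat_const leq_mul2r max_card orbT.
Qed.

Section Embedding.

Variables (T : finType) (adj : rel T) (col : {set T} -> bool).

Definition colored c : rel T := fun x y => adj x y && (col [set x; y] == c).

Lemma colored_sym : symmetric adj -> forall c, symmetric (colored c).
Proof. by move=> adj_sym c x y; rewrite /colored adj_sym setUC. Qed.

Definition compatible c b : rel T :=
  fun x y => [&& x != y, adj x y == b & b ==> (col [set x; y] == c)].

Variables (q k : nat) (c : bool) (A : {set T}) (L : nat -> {set T}) (st : nat -> nat).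
Variable F : rel nat.

Local Notation theta := (2 ^ (7 * q)).
Local Notation s := (2 ^ k).
Local Notation C := (2 ^ k + (2 * k + 5) * 2 ^ k + 2 * k + 8).

Definition nbr c x (W : {set T}) := W :&: [set y | colored c x y].

(* The state once [f] has embedded the positions below [t]. In a leaf not yet entered, each step halves [V j] up to an error, and [cand_before] accumulates these errors additively instead of multiplying factors [1/2 - o(1)]. *)
Record candidates t (V : nat -> {set T}) (f : nat -> T) : Prop := Candidates {
  cand_done : forall i j, i < j < t -> compatible c (F i j) (f i) (f j);
  cand_compat : forall i j, i < t <= j -> j < s ->
    forall x, x \in V j -> compatible c (F i j) (f i) x;
  cand_sub : forall j, t <= j < s -> V j \subset L j;
  cand_before : forall j, t <= j < s -> t <= st j ->
    2 ^ (k + 3) * #|L j| <=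
      2 ^ (t + (k + 3)) * #|V j| + t * (2 * #|L j| + 5 * 2 ^ (s + (k + 3)) * theta);
  cand_inside : forall j, t <= j < s -> st j < t ->
    #|L j| <= 2 ^ (st j + 1 + (2 * k + 5) * (t - st j)) * #|V j|;
  cand_sparse : forall i j, t <= i < j -> j < s -> st i <> st j ->
    forall x, x \in V i ->
    2 ^ (t + (k + 3)) * #|nbr (~~ c) x (V j)| <= #|L j| + 2 ^ (t + (k + 3)) * theta }.

(* The candidates [x] for [i] whose wrong-colored degree into a later candidate set would not be halved by the choice of [v]. *)
Definition spoiled (V : nat -> {set T}) i v := [set x in V i | [exists j : 'I_s,
  [&& i < j, st i != st j & ~~ typical adj theta (nbr (~~ c) x (V j)) v]]].

Definition refine (V : nat -> {set T}) t v i := [set x in V i | compatible c (F t i) v x] :\: spoiled V i v.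

Hypothesis le_kq : k <= q.
Hypothesis card_le : #|T| <= 2 ^ (8 * q).
Hypothesis pseudo : forall W, #|[set v | ~~ typical adj theta W v]| <= 2 ^ (2 * q).
Hypothesis lay : layered colored k (2 ^ (7 * q + C)) c s A L st.

Lemma candidates0 f : candidates 0 L f.
Proof.
split=> // [i j| j _ _|i j ltij ltj neq x Lx]; [by lia | by rewrite mul0n addn0 |].
by rewrite add0n; apply: leq_trans (layered_cross lay _ neq Lx) (leq_addr _ _); lia.
Qed.

(** When the leaf is entered, at [t = st j], the additive errors of [cand_before] are at most half
    of its left side, so they cost a single factor 2. *)
Lemma cand_inside_le t V f j : candidates t V f -> t <= j < s -> st j <= t ->
  #|L j| <= 2 ^ (st j + 1 + (2 * k + 5) * (t - st j)) * #|V j|.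
Proof.
move=> cand ltj; rewrite leq_eqVlt => /predU1P[eqt|]; last exact: cand_inside cand _ ltj.
rewrite eqt subnn muln0 addn0; have := cand_before cand ltj; rewrite eqt => /(_ (leqnn _)).
have leM : 2 ^ (7 * q + C) <= #|L j| by apply: (layered_card lay); lia.
have : 20 * 2 ^ k * 2 ^ s * theta <= #|L j|.
  apply: leq_trans leM; apply: (@leq_trans (2 ^ (5 + k + s + 7 * q))).
    by move: (7 * q) => r; rewrite !expnD !leq_pmul2r ?expn_gt0 //.
  by rewrite leq_exp2l //; lia.
have : t <= s by lia.
have := expn_gt0 2 k; move: theta => z; rewrite addn1 expnS !expnD.
move: (2 ^ t) (2 ^ s) => a S; move: s => u u_gt0 letu h1 h2.
have : t * (2 * #|L j| + 5 * (S * (u * 8)) * z) <= u * (2 * #|L j| + 5 * (S * (u * 8)) * z).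
  exact: leq_mul.
have : u * (20 * u * S * z) <= u * #|L j| by rewrite leq_mul2l h1 orbT.
rewrite -[2 ^ 3]/8 in h2 *; move=> hu ht; rewrite -(leq_pmul2l u_gt0); nia.
Qed.

(** Of the [C] spare bits, shrinking uses at most [s + 1 + (2 * k + 5) * s]; the other [2 * k + 7]
    remain on top of [theta]. *)
Lemma cand_large t V f j : candidates t V f -> t <= j < s -> st j <= t ->
  2 ^ (7 * q + (2 * k + 7)) <= #|V j|.
Proof.
move=> cand ltj let_st; have leL := cand_inside_le cand ltj let_st.
have leM : 2 ^ (7 * q + C) <= #|L j| by apply: (layered_card lay); lia.
have {leM leL} := leq_trans leM leL; set d := st j + 1 + _ => leM.
have le_d : d <= s + 1 + (2 * k + 5) * s.
  by rewrite leq_add ?leq_add2r ?leq_mul2l ?orbT //; lia.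
rewrite -(leq_pmul2l (expn_gt0 2 d)); apply: leq_trans leM.
by rewrite -expnD leq_exp2l //; lia.
Qed.

(** Each [x] is spoiled by at most [s * 2 ^ (2 * q)] vertices [v]; summing over at most
    [2 ^ (8 * q)] vertices [x] and dividing by [theta] gives the bound. *)
Lemma card_spoiled V i :
  #|[set v | 2 ^ (7 * q) <= #|spoiled V i v|]| <= 2 ^ (3 * q + k).
Proof.
set B := [set v | _].
have le_sum : #|B| * theta <= \sum_v #|spoiled V i v|.
  rewrite -sum_nat_const [leqRHS](bigID (mem B)) /=; apply: leq_trans (leq_addr _ _).
  by apply: leq_sum => v; rewrite inE.
have le_pairs : \sum_v #|spoiled V i v| <= 2 ^ (8 * q) * (s * 2 ^ (2 * q)).
  pose e x v := [exists j : 'I_s,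
    [&& i < j, st i != st j & ~~ typical adj theta (nbr (~~ c) x (V j)) v]].
  have -> : \sum_v #|spoiled V i v| = \sum_(x in V i) #|[set v | e x v]|.
    transitivity (\sum_v \sum_(x in V i) (e x v : nat)).
      apply: eq_bigr => v _; rewrite -sum1_card big_mkcond [RHS]big_mkcond.
      by apply: eq_bigr => x _; rewrite inE -/(e x v); case: (x \in V i); case: (e x v).
    rewrite exchange_big; apply: eq_bigr => x _.
    by rewrite -sum1dep_card [RHS]big_mkcond; apply: eq_bigr => v _; case: (e x v).
  apply: (@leq_trans (\sum_(x in V i) s * 2 ^ (2 * q))); last first.
    by rewrite sum_nat_const leq_mul2r (leq_trans (max_card _)) ?orbT.
  apply: leq_sum => x _; rewrite -[s in s * _]card_ord.
  apply: leq_trans (card_bigcup_le (P := xpredT) (B := fun j : 'I_s =>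
    [set v | ~~ typical adj theta (nbr (~~ c) x (V j)) v]) _); last by move=> j _.
  apply: subset_leq_card; apply/subsetP => v; rewrite inE => /existsP[j /and3P[_ _ bad]].
  by apply/bigcupP; exists j; rewrite // inE.
rewrite -(leq_pmul2r (expn_gt0 2 (7 * q))) -expnD.
apply: leq_trans (leq_trans le_sum le_pairs) _.
by rewrite -!expnD leq_exp2l //; lia.
Qed.

(** The violators of the last three conditions lie in [B1], [B2] and [B3], each at most a quarter of
    the size of [V t]. *)
Lemma good_vertex t V f : candidates t V f -> t < s ->
  exists v, [/\ v \in V t,
    forall j, t < j < s -> typical adj theta (V j) v,
    forall j, t < j < s -> st t = st j ->
      #|V j| <= 2 ^ (2 * k + 4) * #|nbr c v (V j)|
  & forall i, t < i < s -> #|spoiled V i v| < theta].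
Proof.
move=> cand lts; have st_le := layered_start lay.
have largeV : 2 ^ (7 * q + (2 * k + 7)) <= #|V t|.
  by apply: cand_large cand _ _ => //; rewrite leqnn.
pose B1 := \bigcup_(j < s) [set v | ~~ typical adj theta (V j) v].
pose X j := [set v in V t | 2 ^ (2 * k + 4) * #|nbr c v (V j)| < #|V j|].
pose B2 := \bigcup_(j < s | (t < j) && (st t == st j)) X j.
pose B3 := \bigcup_(i < s) [set v | theta <= #|spoiled V i v|].
have leB1 : #|B1| <= s * 2 ^ (2 * q).
  by rewrite -[s in s * _]card_ord; apply: card_bigcup_le => j _.
have leB3 : #|B3| <= s * 2 ^ (3 * q + k).
  by rewrite -[s in s * _]card_ord; apply: card_bigcup_le => j _; apply: card_spoiled.
have leX (j : 'I_s) : (t < j) && (st t == st j) -> 2 ^ (k + 2) * #|X j| <= #|V t|.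
  move=> /andP[ltj /eqP eq_st]; have ltjs := ltn_ord j.
  have [|eqL [z ltz bd]] := layered_same lay _ eq_st; first lia.
  have leLj := cand_inside_le cand (j := j).
  have leLt := cand_inside_le cand (j := t).
  have := st_le t; set u := st j + 1 + (2 * k + 5) * (t - st j) => le_t.
  have le_scale : u + (k + 2) <= scale k z.
    have : (2 * k + 5) * (t - st j) <= (2 * k + 5) * z by rewrite leq_mul2l; lia.
    by rewrite /scale /u; lia.
  (* Were [X j] large, bidensity applied to [X j] and [V j] would yield a vertex of [X j] of high
     degree into [V j], against the choice of [X j]. *)
  rewrite leqNgt; apply/negP => ltX.
  have [||||x] := bd (X j) (V j).
  - apply: subset_trans (subset_trans _ (cand_sub cand (j := t) _)) _.
    + by rewrite /X setIdE subsetIl.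
    + by rewrite leqnn.
    + by rewrite eqL.
  - by apply: (cand_sub cand); lia.
  - rewrite -eqL; apply: leq_trans (leLt _ _) _ => //; first lia.
    rewrite eq_st -/u; apply: (@leq_trans (2 ^ u * (2 ^ (k + 2) * #|X j|))).
      by rewrite leq_mul2l ltnW ?orbT.
    by rewrite mulnA -expnD leq_mul2r leq_exp2l ?le_scale ?orbT.
  - apply: leq_trans (leLj _ _) _; try lia.
    by rewrite -/u leq_mul2r leq_exp2l // (leq_trans (leq_addr _ _) le_scale) orbT.
  - by rewrite inE ltnNge => /andP[_ /negP].
have leB2 : 4 * #|B2| <= #|V t|.
  have leXdiv (j : 'I_s) : (t < j) && (st t == st j) -> #|X j| <= #|V t| %/ 2 ^ (k + 2).
    by move=> /leX le; rewrite leq_divRL ?expn_gt0 // mulnC.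
  have := card_bigcup_le leXdiv; rewrite card_ord -/B2 => leB2.
  apply: (leq_trans (leq_mul (leqnn _) leB2)).
  by rewrite mulnA -[4]/(2 ^ 2) -expnD addnC mulnC leq_trunc_div.
have ltV : #|B1 :|: B2 :|: B3| < #|V t|.
  apply: leq_ltn_trans (leq_card_setU _ _) _.
  apply: leq_ltn_trans (leq_add (leq_card_setU _ _) (leqnn _)) _.
  have le1 : 4 * (s * 2 ^ (2 * q)) <= #|V t|.
    by apply: leq_trans largeV; rewrite -[4]/(2 ^ 2) -!expnD leq_exp2l //; lia.
  have le3 : 4 * (s * 2 ^ (3 * q + k)) <= #|V t|.
    by apply: leq_trans largeV; rewrite -[4]/(2 ^ 2) -!expnD leq_exp2l //; lia.
  have gt0 : 0 < #|V t| by apply: leq_trans largeV; rewrite expn_gt0.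
  lia.
have /subsetPn[v Vv] : ~~ (V t \subset B1 :|: B2 :|: B3).
  by apply: contraTN ltV => /subset_leq_card; rewrite -leqNgt.
rewrite !inE !negb_or => /andP[/andP[nB1 nB2] nB3]; exists v; split=> // [j ltj|j ltj eq_st|i lti].
- have ltjs : j < s by lia.
  by apply: contraNT nB1 => nt; apply/bigcupP; exists (Ordinal ltjs); rewrite // inE.
- have ltjs : j < s by lia.
  rewrite leqNgt; apply: contraNN nB2 => lt.
  apply/bigcupP; exists (Ordinal ltjs); first by rewrite eq_st eqxx andbT; case/andP: ltj.
  by rewrite inE Vv.
- have ltis : i < s by lia.
  by rewrite ltnNge; apply: contraNN nB3 => le; apply/bigcupP; exists (Ordinal ltis); rewrite // inE.
Qed.

(** The incompatible vertices are [v] itself, whence the [1], and, only when an edge is wanted, the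
    wrong-colored neighbors. *)
Lemma card_compatible_nbr b v (W : {set T}) :
  #|[set w in W | adj v w == b]| <=
    #|[set w in W | compatible c b v w]| + b * #|nbr (~~ c) v W| + 1.
Proof.
set G := [set w in W | compatible _ _ _ _]; set S := nbr _ _ _.
have sN : [set w in W | adj v w == b] \subset [set v] :|: G :|: (if b then S else set0).
  apply/subsetP => w; rewrite !inE => /andP[Ww adj_vw]; rewrite Ww eq_sym /compatible adj_vw.
  case: eqVneq => //= _; move: adj_vw; case: (b) => [/eqP adj_vw|//] /=.
  by rewrite !inE Ww /colored adj_vw /=; case: c (col _) => [] [].
apply: leq_trans (subset_leq_card sN) _.
apply: leq_trans (leq_card_setU _ _) _.
have [+ _] := leq_card_setU [set v] G; rewrite cards1.
by rewrite (fun_if (fun B : {set T} => #|B|)) cards0; case: (b); lia.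
Qed.

Lemma card_compatible_colored v (W : {set T}) :
  #|nbr c v W| <= #|[set w in W | compatible c true v w]| + 1.
Proof.
rewrite addnC -(cards1 v); apply: leq_trans (subset_leq_card _) (leq_card_setU _ _).
apply/subsetP => w; rewrite !inE /compatible /colored => /and3P[-> -> ->].
by rewrite eq_sym; case: eqVneq.
Qed.

Lemma card_refine (V : nat -> {set T}) t v i :
  #|[set x in V i | compatible c (F t i) v x]| <= #|refine V t v i| + #|spoiled V i v|.
Proof.
rewrite -(cardsID (spoiled V i v)) addnC leq_add2l.
by apply: subset_leq_card; apply: subsetIr.
Qed.

Lemma candS t V f : candidates t V f -> t < s ->
  exists V' f', candidates t.+1 V' f'.
Proof.
move=> cand lts; have [v [Vv typ_v rich_v few]] := good_vertex cand lts.
exists (refine V t v), (fun i => if i == t then v else f i).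
have sub_refine j : refine V t v j \subset V j.
  by apply: subset_trans (subsetDl _ _) _; rewrite setIdE subsetIl.
have same_or_after j : t < j -> j < s -> st t = st j \/ t < st j.
  by move=> ltj ltjs; apply: (layered_block lay); rewrite ltj.
have st_le := layered_start lay.
have le_nbr j b : #|[set w in V j | adj v w == b]| <=
    #|[set x in V j | compatible c b v x]| + b * #|nbr (~~ c) v (V j)| + 1.
  exact: card_compatible_nbr.
have typ j b : t < j < s -> #|V j| <= 2 * #|[set w in V j | adj v w == b]| + theta.
  by move=> /typ_v /forallP/(_ b)/andP[].
have le_refine j : t < j < s ->
    #|[set x in V j | compatible c (F t j) v x]| + 1 <= #|refine V t v j| + theta.
  move=> ltj; have := few _ ltj; have := card_refine V t v j; lia.
split=> [i j /andP[ltij]|i j /andP[lti ltj] ltjs x|j ltj|j ltj let_st|j ltj lt_st|i j lti ltjs neq_st x].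
- rewrite ltnS leq_eqVlt => /predU1P[eqj|ltj].
    by rewrite eqj eqxx ltn_eqF -?eqj // eqj; apply: (cand_compat cand); rewrite -?eqj ?ltij ?leqnn // eqj.
  by rewrite !ltn_eqF ?(ltn_trans ltij) //; apply: (cand_done cand); rewrite ltij.
- case: eqVneq => [->|neq]; first by rewrite !inE => /and3P[].
  move=> /(subsetP (sub_refine _)); apply: (cand_compat cand) => //.
  by rewrite (ltnW ltj) andbT; lia.
- by apply: subset_trans (sub_refine _) _; apply: (cand_sub cand); lia.
- have ltj' : t < j < s by lia.
  have neq_st : st t <> st j by have := st_le t; lia.
  have lej : t <= j < s by lia.
  have lett : t <= t < j by lia.
  have ltjs : j < s by lia.
  have := cand_before cand lej (ltnW let_st).
  have := cand_sparse cand lett ltjs neq_st Vv.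
  have := typ j (F t j) ltj'; have := le_nbr j (F t j); have := le_refine j ltj'.
  have : 2 ^ (t + (k + 3)) <= 2 ^ (s + (k + 3)) by rewrite leq_exp2l // leq_add2r ltnW.
  have : F t j * #|nbr (~~ c) v (V j)| <= #|nbr (~~ c) v (V j)| by case: (F t j); lia.
  rewrite addSn [2 ^ (t + _).+1]expnS.
  move: (2 ^ (t + _)) (2 ^ (s + _)) (2 ^ (k + 3)) theta => u U h z.
  set S := #|nbr _ _ _|; set b := F t j * S; set a := #|[set _ in _ | compatible _ _ _ _]|.
  set N := #|[set w in V j | _]|; move: a b N => a b N; move: S #|L j| #|V j| #|refine V t v j| => S l w w'.
  move=> h1 h2 h3 h4 h5 h6 h7.
  (* Typicality costs [z], and spoiled vertices twice [z]. As [cand_sparse] gives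
     [u * S <= l + u * z], the total error is [2 * l + 5 * u * z], the increment in
     [cand_before]. *)
  have h8 : w <= 2 * w' + 3 * z + 2 * S by lia.
  have h9 : u * w <= u * (2 * w' + 3 * z + 2 * S) by rewrite leq_mul2l h8 orbT.
  have h10 : u * z <= U * z by rewrite leq_mul2r h2 orbT.
  by nia.
- have ltj' : t < j < s by lia.
  have eq_st : st t = st j by case: (same_or_after j); lia.
  have le_st : st j <= t by rewrite -eq_st.
  apply: leq_trans (cand_inside_le cand (j := j) _ le_st) _; first lia.
  have -> : st j + 1 + (2 * k + 5) * (t.+1 - st j) =
    (st j + 1 + (2 * k + 5) * (t - st j)) + (2 * k + 5) by rewrite subSn // mulnS; lia.
  rewrite [2 ^ (_ + (2 * k + 5))]expnD -mulnA leq_mul2l; apply/orP; right.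
  have large : 2 ^ (2 * k + 7) * theta <= #|V j|.
    rewrite mulnC -expnD; apply: (cand_large cand) => //; lia.
  have := le_refine j ltj'.
  have := typ j (F t j) ltj'; have := le_nbr j (F t j).
  (* A non-edge only halves [V j], up to errors. For an edge, wrong-colored degrees within a leaf
     are not controlled, and bidensity is used instead, with one bit to absorb [theta]. *)
  case: (F t j); last first.
    rewrite mul0n addn0 => h1 h2 h3.
    have le5 : 2 ^ 5 <= 2 ^ (2 * k + 5) by rewrite leq_exp2l // leq_addl.
    have le7 : 2 ^ 5 <= 2 ^ (2 * k + 7) by rewrite leq_exp2l //; lia.
    have {le7}large := leq_trans (leq_mul le7 (leqnn theta)) large.
    apply: leq_trans (leq_mul le5 (leqnn _)); move: large h1 h2 h3.
    rewrite -[2 ^ 5]/32; move: theta => z; lia.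
  move=> _ _ h; have := rich_v j ltj' eq_st; have := card_compatible_colored v (V j).
  move: large; have -> : 2 ^ (2 * k + 7) = 2 ^ (2 * k + 4) * 2 ^ 3 by rewrite -expnD; congr (2 ^ _); lia.
  have -> : 2 ^ (2 * k + 5) = 2 * 2 ^ (2 * k + 4) by rewrite -expnS; congr (2 ^ _); lia.
  rewrite -[2 ^ 3]/8; move: (2 ^ (2 * k + 4)) theta h => u z h large h1 h2.
  have := leq_mul (leqnn u) (leq_trans h1 h); nia.
(* As [x] is not spoiled, [v] halves its wrong-colored neighborhood up to [theta]; the additive
   error stays at [theta], since [(theta + theta) / 2 = theta]. *)
- have le_x : #|nbr (~~ c) x (refine V t v j)| <=
      #|[set w in nbr (~~ c) x (V j) | adj v w == F t j]|.
    apply: subset_leq_card; apply/subsetP => w; rewrite !inE.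
    by rewrite /compatible => /andP[/and3P[_ -> /and3P[_ -> _]] ->].
  rewrite !inE => /andP[+ /andP[Vix _]]; rewrite Vix /= => /existsPn/(_ (Ordinal ltjs)) /=.
  rewrite (introN eqP neq_st) (_ : i < j) ?negbK; last by case/andP: lti.
  move=> /forallP/(_ (F t j))/andP[_].
  have leij : t <= i < j by lia.
  have := cand_sparse cand leij ltjs neq_st Vix; move: le_x; rewrite addSn expnS.
  move: (2 ^ (t + _)) theta => u z; nia.
Qed.

Lemma embedding_exists : 0 < #|T| ->
  exists f : nat -> T, forall i j, i < j < s -> compatible c (F i j) (f i) (f j).
Proof.
move=> /card_gt0P[x0 _].
have [V [f cand]] : exists V f, candidates s V f.
  elim: {-2}s (leqnn s) => [|t IH] lts; first by exists L, (fun=> x0); apply: candidates0.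
  by have [V [f cand]] := IH (ltnW lts); apply: candS cand lts.
by exists f => i j; apply: (cand_done cand).
Qed.

End Embedding.

(** * The induced Ramsey number *)

Lemma induced_copy (G H : sgraph) (col : {set G} -> bool) (c : bool) (g : H -> G) :
  (forall x y, x != y -> compatible (@adj G) col c (adj x y) (g x) (g y)) ->
  exists S : {set G}, isomorphic (Defs.induced S) H /\ monochromatic col S.
Proof.
move=> comp.
have g_inj : injective g.
  by move=> x y; apply: contra_eq => /comp/andP[].
have g_adj x y : adj (g x) (g y) = adj x y.
  by have [->|/comp/and3P[_ /eqP]//] := eqVneq x y; rewrite !adj_irr.
exists [set g x | x in H]; split.
  pose g' x : Defs.induced [set g x | x in H] := exist _ (g x) (imset_f g (isT : x \in H)).
  have g'_inj : injective g' by move=> x y [] /g_inj.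
  have /(inj_card_bij g'_inj)[f gK fK] : #|Defs.induced [set g x | x in H]| <= #|H|.
    by rewrite card_sig (leq_trans _ (leq_imset_card g _)).
  exists f; split; first by exists g'.
  by move=> x y; rewrite -[in RHS](fK x) -[in RHS](fK y) [RHS]g_adj.
exists c => e; rewrite inE => /existsP[u /existsP[v /andP[adj_uv /eqP->]]].
rewrite subUset !sub1set => /andP[/imsetP[x _ def_u] /imsetP[y _ def_v]].
move: adj_uv; rewrite {}def_u {}def_v g_adj => adj_xy.
have neq_xy : x != y by apply: contraTneq adj_xy => ->; rewrite adj_irr.
by have /and3P[_ _] := comp x y neq_xy; rewrite adj_xy => /eqP.
Qed.

Definition hadamard_graph d := SGraph (@hadamard_adj_sym d) (@hadamard_adj_irr d).

Lemma card_hadamard_graph q : #|hadamard_graph (4 * q)| = 2 ^ (8 * q).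
Proof. by rewrite card_ffun !card_ord -[8]/(2 * 4)%N -mulnA [RHS]expnM. Qed.

Lemma hadamard_graph_arrow (H : sgraph) k : 0 < k -> #|H| <= 2 ^ k ->
  induced_arrow (hadamard_graph (4 * (64 * k * 2 ^ k))) H.
Proof.
move=> k_gt0 leHk; set q := 64 * k * 2 ^ k; set G := hadamard_graph _ => col.
pose C := 2 ^ k + (2 * k + 5) * 2 ^ k + 2 * k + 8.
have lt_k : k < 2 ^ k by apply: ltn_expl.
have le_kq : k <= q by rewrite /q; move: (2 ^ k) lt_k => s; nia.
(* Of the [8 * q] bits of the host, [7 * q] go to the error [theta]; the last [q] must pay for
   finding the layers and for the embedding. *)
have le_q : C + loss k k k <= q.
  by rewrite /C /loss /q; move: (2 ^ k) lt_k => s; nia.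
have cardG := card_hadamard_graph q; rewrite -/G in cardG.
have large : 2 ^ (7 * q + C) * 2 ^ loss k k k <= #|[set: G]|.
  by rewrite cardsT cardG -expnD leq_exp2l //; lia.
(* Positions from [#|H|] up to [2 ^ k] act as isolated padding vertices. *)
pose F i j := [exists x : H, exists y : H,
  [&& (enum_rank x == i :> nat), (enum_rank y == j :> nat) & adj x y]].
have FE (x y : H) : F (enum_rank x) (enum_rank y) = adj x y.
  apply/existsP/idP => [[x' /existsP[y' /and3P[/eqP eq_x /eqP eq_y]]]|adj_xy].
    by rewrite (enum_rank_inj (ord_inj eq_x)) (enum_rank_inj (ord_inj eq_y)).
  by exists x; apply/existsP; exists y; rewrite !eqxx.
have embed c : (exists L st, layered (colored (@adj G) col) k (2 ^ (7 * q + C)) c (2 ^ k) [set: G] L st) ->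
    exists S : {set G}, isomorphic (Defs.induced S) H /\ monochromatic col S.
  move=> [L [st lay]].
  have cardG_gt0 : 0 < #|G| by rewrite cardG expn_gt0.
  have [|f fP] := embedding_exists F le_kq _ (@hadamard_typical q) lay cardG_gt0.
    by rewrite cardG.
  apply: (@induced_copy _ _ col c (fun x => f (enum_rank x))) => x y neq_xy.
  have lt_rank (z : H) : enum_rank z < 2 ^ k by apply: leq_trans leHk; apply: ltn_ord.
  have : enum_rank x != enum_rank y :> nat by rewrite val_eqE (inj_eq enum_rank_inj).
  rewrite neq_ltn => /orP[lt|lt].
    by rewrite -FE fP // lt lt_rank.
  rewrite adj_sym -FE /compatible eq_sym adj_sym setUC.
  by apply: fP; rewrite lt lt_rank.
have col_sym := colored_sym col (@adj_sym G).
have [|ex|ex] := layered_exists true col_sym _ (leqnn k) (leqnn k) large; first by rewrite expn_gt0.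
- exact: embed ex.
- exact: embed ex.
Qed.

Lemma is_r_ind_exists (G H : sgraph) : induced_arrow G H ->
  exists2 N, is_r_ind H N & N <= #|G|.
Proof.
move=> arrowG; pose P N := `[< exists G : sgraph, #|G| = N /\ induced_arrow G H >].
have exP : exists N, P N by exists #|G|; apply/asboolP; exists G.
case: (ex_minnP exP) => N /asboolP PN minN; exists N.
  by split=> // G' arrowG'; apply: minN; apply/asboolP; exists G'.
by apply: minN; apply/asboolP; exists G.
Qed.

Lemma induced_arrow_small (H : sgraph) : #|H| <= 1 -> induced_arrow H H.
Proof.
move=> leH1 col; apply: (@induced_copy H H col true id) => x y.
by have /fintype_le1P/(_ x y)-> := leH1; rewrite eqxx.
Qed.

(** Rounding up gives [2 ^ k <= 2 * n <= n ^ 2], hence [k <= 2 * log2 n]; the constant is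
    [2048 = 8 * 64 * 2 * 2]. *)
Lemma pow_le_powR (R : realType) (n k : nat) : (1 < n)%N -> k = up_log 2 n ->
  ((2 ^ (8 * (64 * k * 2 ^ k)))%:R <= 2 `^ (2048 * n%:R * log2 n%:R) :> R)%R.
Proof.
move=> n_gt1 def_k.
have /andP[lt_kn _] : 2 ^ k.-1 < n <= 2 ^ k by rewrite def_k; apply: up_log_bounds.
have k_gt0 : 0 < k by rewrite def_k up_log_gt0.
have le_2n : 2 ^ k <= 2 * n by rewrite -(prednK k_gt0) expnS leq_mul2l ltnW.
have ln2_gt0 : (0 < ln 2 :> R)%R by rewrite ln_gt0 // ltr1n.
have le_k : (k%:R <= 2 * log2 n%:R :> R)%R.
  rewrite /log2 mulrA ler_pdivlMr //.
  have -> : (k%:R * ln 2 = ln (2 ^+ k) :> R)%R by rewrite lnXn ?ltr0n // mulr_natl.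
  have -> : (2 * ln n%:R = ln (n%:R ^+ 2) :> R)%R.
    by rewrite lnXn ?ltr0n ?(ltnW n_gt1) // mulr_natl.
  rewrite -!natrX ler_ln ?posrE ?ltr0n ?expn_gt0 ?(ltnW n_gt1) // ler_nat.
  by apply: (leq_trans le_2n); rewrite -mulnn leq_mul2r n_gt1 orbT.
rewrite natrX -powR_mulrn // ler_powR ?ler1n //.
apply: (@le_trans _ _ (512 * (k%:R * (2 * n)%:R))%R).
  rewrite -!natrM ler_nat; move: (2 ^ k) le_2n => s; nia.
have -> : (2048 * n%:R * log2 n%:R = 512 * (2 * log2 n%:R * (2 * n)%:R) :> R)%R by rewrite natrM; ring.
by rewrite ler_pM2l // ler_wpM2r.
Qed.

Theorem theorem1p2 (R : realType) :
  exists c : R, forall (n : nat) (H : sgraph), #|H| = n ->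
    exists N : nat, is_r_ind H N /\
      (N%:R <= 2 `^ (c * n%:R * log2 n%:R) :> R)%R.
Proof.
exists 2048%R => n H cardH; have [n_gt1|n_le1] := ltnP 1 n.
  pose k := up_log 2 n.
  have k_gt0 : 0 < k by rewrite up_log_gt0.
  have leHk : #|H| <= 2 ^ k by rewrite cardH; have /andP[] := up_log_bounds (isT : 1 < 2) n_gt1.
  have [N rN leN] := is_r_ind_exists (hadamard_graph_arrow k_gt0 leHk).
  exists N; split=> //; apply: le_trans (pow_le_powR R n_gt1 (erefl k)).
  by rewrite ler_nat -card_hadamard_graph.
have [|N rN leN] := is_r_ind_exists (@induced_arrow_small H _); first by rewrite cardH.
exists N; split=> //.
(* The exponent vanishes through the factor [n] if [n = 0] and through [ln 1 = 0] if [n = 1]; the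
   bound 1 is met with [H] as its own host. *)
have -> : (2048 * n%:R * log2 n%:R = 0 :> R)%R.
  by case: n n_le1 {cardH} => [|[|//]] _; rewrite ?mulr0 ?mul0r // /log2 ln1 mul0r mulr0.
by rewrite powRr0 lern1 (leq_trans leN) // cardH.
Qed.
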